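(* Let $r$ and $k$ be positive integers with $k>r\ge 2$, and let $G$ be a graph with $\chi(G)\le r$. Let $P\subset V(G)$ and let $d\colon P\to[r+k]$ be a precoloring of $P$ in $G$. (1) If $r<k\le\frac{3r-7}{2}$ and $|\mathcal{D}_G(P,2)|<\min\left\{\frac12(k+3r-4)(k-r+3),\ (k-r+2)(k+r-1)\right\}$, then $d$ can be extended to an $(r+k)$-coloring of $G$. (2) If $k>\frac{3r-7}{2}$ and $|\mathcal{D}_G(P,2)|<\min\left\{\frac12(k+1)(k+2),\ (k-r+2)(k+r-1)\right\}$, then $d$ can be extended to an $(r+k)$-coloring of $G$.
   Context: For a graph $G$, $P\subset V(G)$ and a positive integer $k$, $\mathcal{D}_G(P,k)=\{\{x,y\}\subset P: x\ne y,\ d_G(x,y)\le k\}$, where $d_G$ is the distance in $G$. $[m]=\{1,\dots,m\}$. A precoloring of $P$ in $G$ is a proper coloring of $G[P]$; an $m$-coloring of $G$ is a proper coloring using at most $m$ colors; $d$ is extended by a coloring $f$ of $G$ if $f(v)=d(v)$ for all $v\in P$. *)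

(* Defs.v *)
From mathcomp Require Import all_boot.
Set Implicit Arguments. Unset Strict Implicit. Unset Printing Implicit Defensive.

Definition simple_graph (T : finType) (e : rel T) : Prop :=
  symmetric e /\ irreflexive e.

(* walk_le e n x y : there is a walk of length at most n from x to y,
   i.e. d_G(x,y) <= n. *)
Fixpoint walk_le (T : finType) (e : rel T) (n : nat) (x y : T) : bool :=
  match n with
  | 0 => x == y
  | n'.+1 => walk_le e n' x y || [exists z, e x z && walk_le e n' z y]
  end.

Definition proper_coloring (T : finType) (e : rel T) (m : nat) (f : T -> 'I_m) : Prop :=
  forall x y, e x y -> f x != f y.

Definition colorable (T : finType) (e : rel T) (r : nat) : Prop :=
  exists f : T -> 'I_r, proper_coloring e f.

(* d is a precoloring of P: a proper coloring of G[P] (values off P irrelevant). *)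
Definition precoloring (T : finType) (e : rel T) (P : {set T}) (m : nat) (d : T -> 'I_m) : Prop :=
  forall x y, x \in P -> y \in P -> e x y -> d x != d y.

Definition Dset (T : finType) (e : rel T) (P : {set T}) (k : nat) : {set {set T}} :=
  [set S : {set T} | (S \subset P) && (#|S| == 2) &&
     [forall x in S, forall y in S, (x != y) ==> walk_le e k x y]].

Definition extends_to_coloring (T : finType) (e : rel T) (P : {set T}) (m : nat) (d : T -> 'I_m) : Prop :=
  exists f : T -> 'I_m, proper_coloring e f /\ forall v, v \in P -> f v = d v.

(* Main.v *)
Require Import Defs.
From mathcomp Require Import all_boot perm.
From mathcomp Require Import zify.
Set Implicit Arguments. Unset Strict Implicit. Unset Printing Implicit Defensive.

(* Fix a proper coloring of the graph with [r] classes and call a pair of the [n = r + k]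
   colors null if no two precolored vertices at distance at most 2 carry it.  Given
   [r - 1] disjoint null pairs, use each of them as the list of one class and the
   remaining [k - r + 2] colors [R] as the list of the last class: a vertex cannot see both
   colors of a null pair, so the extension exists unless, whichever class is last, some
   vertex of it sees all of [R].  In that case each pair of colors in [R] is carried by at
   least two close pairs of precolored vertices, and exchanging a color of [R] with one
   of a null pair yields (k - r + 2)(k + r - 1) close pairs in total.  The null pairs exist
   by the Erdos-Gallai bound on graphs without [r - 1] disjoint edges, proved by shifting. *)

(** A two-element set comes from exactly two ordered pairs; this turns sizes of families of pairs
    into double sums. *)
Lemma card_ordered_pairs (T : finType) (F : {set {set T}}) :
    {in F, forall A : {set T}, #|A| = 2} ->
  #|[set p : T * T | [set p.1; p.2] \in F]| = 2 * #|F|.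
Proof.
move=> F2; rewrite -sum1_card (partition_big (fun p => [set p.1; p.2]) (mem F)) /=; last first.
  by move=> p; rewrite inE.
rewrite mulnC -sum_nat_const; apply: eq_bigr => A FA.
have /eqP/cards2P[x [y [xy defA]]] := F2 A FA.
transitivity #|[set (x, y); (y, x)]|; last by rewrite cards2 xpair_eqE negb_and xy.
rewrite -sum1_card; apply: eq_bigl => -[u v]; rewrite !inE /= !xpair_eqE.
apply/andP/orP => [[_ /eqP]|].
  rewrite defA => /setP E; move: (E x) (E y) (E u) (E v); rewrite !inE !eqxx ?orbT /=.
  rewrite (eq_sym x u) (eq_sym x v) (eq_sym y u) (eq_sym y v).
  have [->|_] /= := eqVneq u x; first by rewrite (negPf xy) /= => _ ->; left.
  by move=> -> _ <-; right.
by case=> /andP[/eqP-> /eqP->]; rewrite ?[[set y; x]]setUC -defA FA eqxx.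
Qed.

(** * Shifting of families of pairs and the Erdos-Gallai bound *)

Section Shift.
Context {n : nat}.
Implicit Types (i j : 'I_n) (E M : {set {set 'I_n}}) (A B C : {set 'I_n}).

Definition swap i j A := tperm i j @: A.

(** The compression operator of Erdos, Ko and Rado; a set whose swap already lies in [E] stays put,
    which keeps the map injective on [E]. *)
Definition shift i j E A :=
  if [&& j \in A, i \notin A & swap i j A \notin E] then swap i j A else A.

(** Potential for repeated shifting: it drops whenever a shift with [i < j] moves a set. *)
Definition weight A := \sum_(x in A) x.

Lemma in_swap i j A x : (x \in swap i j A) = (tperm i j x \in A).
Proof. by rewrite -{1}(tpermK i j x) mem_imset //; apply: perm_inj. Qed.

Lemma swapK i j : involutive (swap i j).
Proof. by move=> A; apply/setP=> x; rewrite !in_swap tpermK. Qed.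

Lemma card_swap i j A : #|swap i j A| = #|A|.
Proof. by rewrite card_imset //; apply: perm_inj. Qed.

Lemma card_shift i j E A : #|shift i j E A| = #|A|.
Proof. by rewrite /shift; case: ifP => // _; rewrite card_swap. Qed.

Lemma weight_swap i j A : i < j -> j \in A -> i \notin A -> weight (swap i j A) < weight A.
Proof.
move=> ltij jA iA; rewrite /weight big_imset /=; last by move=> x y _ _; apply: perm_inj.
rewrite (bigD1 j) //= [X in _ < X](bigD1 j) //= tpermR -addSn leq_add //.
apply/eq_leq/eq_bigr => x /andP[xA xj]; rewrite tpermD //; last by rewrite eq_sym.
by apply: contraNneq iA => ->.
Qed.

Lemma weight_shift i j E A : i < j -> weight (shift i j E A) <= weight A.
Proof. by rewrite /shift => ltij; case: ifP => // /and3P[jA iA _]; apply/ltnW/weight_swap. Qed.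

Lemma shift_inj i j E : {in E &, injective (shift i j E)}.
Proof.
move=> A B EA EB; rewrite /shift.
case: ifP => [/and3P[_ _ nA]|_]; case: ifP => [/and3P[_ _ nB]|_] //.
- exact: (can_inj (swapK i j)).
- by move=> AB; rewrite AB EB in nA.
- by move=> AB; rewrite -AB EA in nB.
Qed.

(* If [M] uses an edge [B] created by the shift, then [B] is the only edge of [M]
   through [i], and an edge of [M] through [j] was left in place because its swap
   was already in [E]; hence swapping [i] and [j] sends all of [M] into [E]. *)
Lemma shift_matching i j E M :
    M \subset shift i j E @: E -> trivIset M ->
  exists M', [/\ M' \subset E, trivIset M' & #|M'| = #|M|].
Proof.
move=> sM tM; have [ME|] := boolP (M \subset E); first by exists M.
case/subsetPn=> B BM nBE; exists (swap i j @: M); split; last first.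
- by rewrite card_imset //; apply: can_inj (swapK i j).
- apply/trivIsetP => _ _ /imsetP[A AM ->] /imsetP[C CM ->] neq.
  have neqAC : A != C by apply: contraNneq neq => ->.
  apply/pred0P => x /=; rewrite !in_swap.
  by have /pred0P/(_ (tperm i j x)) := trivIsetP tM _ _ AM CM neqAC.
have [A EA defB] := imsetP (subsetP sM _ BM).
have [iB jB EsB] : [/\ i \in B, j \notin B & swap i j B \in E].
  move: nBE; rewrite defB /shift; case: ifP => [/and3P[jA iA _] _|_]; last by rewrite EA.
  by rewrite !in_swap tpermL tpermR swapK.
apply/subsetP => _ /imsetP[C CM ->]; have [-> //|neqCB] := eqVneq C B.
have iC : i \notin C.
  have /pred0P/(_ i) /= := trivIsetP tM _ _ CM BM neqCB.
  by rewrite iB andbT => ->.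
have [C' EC' defC] := imsetP (subsetP sM _ CM).
move: defC; rewrite /shift; case: ifP => [/and3P[jC' _ _] defC|].
  by rewrite defC in_swap tpermL jC' in iC.
move=> cond defC; move: cond; rewrite -defC iC /=.
have [jC|jC _] := boolP (j \in C); first by move/negbFE.
suff -> : swap i j C = C by rewrite defC.
apply/setP=> x; rewrite in_swap.
by case: tpermP => [->|->|//]; rewrite (negPf iC) (negPf jC).
Qed.

Definition shifted E :=
  forall i j A, i < j -> A \in E -> j \in A -> i \notin A -> swap i j A \in E.

(** Shift as long as some set still moves: the total weight drops, injectivity keeps the size, and
    [shift_matching] pulls matchings back. *)
Lemma exists_shifted E :
    {in E, forall A : {set 'I_n}, #|A| = 2} ->
  exists E', [/\ shifted E', {in E', forall A : {set 'I_n}, #|A| = 2}, #|E'| = #|E| &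
    forall M, M \subset E' -> trivIset M ->
      exists M', [/\ M' \subset E, trivIset M' & #|M'| = #|M|]].
Proof.
have [w] := ubnP (\sum_(A in E) weight A); elim: w E => // w IH E leEw E2.
pose bad i j A := [&& i < j, A \in E, j \in A, i \notin A & swap i j A \notin E].
have [|no_bad] := boolP [exists i, exists j, exists A, bad i j A]; last first.
  exists E; split=> // [i j A ij EA jA iA|M sM tM]; last by exists M.
  apply: contraNT no_bad => nE; apply/existsP; exists i; apply/existsP; exists j.
  by apply/existsP; exists A; apply/and5P.
case/existsP=> i /existsP[j /existsP[A /and5P[ij EA jA iA nE]]].
have inj := @shift_inj i j E.
have [||E' [sE' E'2 cE' mE']] := IH (shift i j E @: E).
- rewrite ltnS in leEw; apply: leq_trans leEw.
  rewrite big_imset //= (bigD1 A) //= [X in _ < X](bigD1 A) //=.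
  rewrite -addSn leq_add //; first by rewrite {1}/shift jA iA nE weight_swap.
  by apply: leq_sum => B _; apply: weight_shift.
- by move=> _ /imsetP[B EB ->]; rewrite card_shift E2.
exists E'; split=> // [|M sM tM]; first by rewrite cE' card_in_imset.
have [M1 [sM1 tM1 <-]] := mE' M sM tM.
exact: shift_matching sM1 tM1.
Qed.

End Shift.

Lemma swap_pair n (i j a : 'I_n) : i != a -> j != a -> swap i j [set a; j] = [set a; i].
Proof. by move=> ia ja; rewrite /swap imsetU !imset_set1 tpermR tpermD. Qed.

(* Edges of a shifted family missing [{i, q}] have an end below [i] or both ends below [q]. *)
Lemma shifted_missing_pair n (E : {set {set 'I_n}}) (i q : 'I_n) :
    shifted E -> {in E, forall A : {set 'I_n}, #|A| = 2} -> i < q -> [set i; q] \notin E ->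
  #|E| <= 'C(q, 2) + i * (n - q).
Proof.
move=> sE E2 iq nE.
have key (a b : 'I_n) : a < b -> i <= a -> q <= b -> [set a; b] \notin E.
  move=> ab ia qb; apply: contra nE => Eab.
  (* In general [b] is lowered to [q], then [a] to [i]. If [a] is [q], the first move would collapse
     the pair, so [b] goes directly to [i]. *)
  have [qa|qa] := eqVneq a q.
    have ib : i < b by lia.
    have := sE i b _ ib Eab; rewrite !inE eqxx orbT => /(_ isT).
    have nia : i != a by rewrite -val_eqE /=; move: iq; rewrite -qa; lia.
    have nib : i != b by rewrite -val_eqE /=; lia.
    have nba : b != a by rewrite -val_eqE /=; lia.
    by rewrite negb_or nia nib /= swap_pair // qa setUC; apply.
  have Eaq : [set a; q] \in E.
    have [<- //|nqb] := eqVneq b q.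
    have qb' : q < b by rewrite ltn_neqAle qb andbT eq_sym.
    have := sE q b _ qb' Eab; rewrite !inE eqxx orbT => /(_ isT).
    have nba : b != a by rewrite -val_eqE /=; lia.
    by rewrite negb_or (eq_sym q a) qa (eq_sym q b) nqb /= swap_pair ?(eq_sym q a) //; apply.
  have [<- //|nia] := eqVneq a i.
  have ia' : i < a by rewrite ltn_neqAle ia andbT eq_sym.
  have := sE i a _ ia' Eaq; rewrite !inE eqxx => /(_ isT).
  have niq : i != q by rewrite -val_eqE /=; lia.
  rewrite negb_or (eq_sym i a) nia niq /= setUC swap_pair // 1?setUC; by [apply|].
pose low := [set x : 'I_n | x < q].
have card_lt (m : 'I_n) : #|[set x : 'I_n | x < m]| = m.
  rewrite -sum1dep_card (big_ord_narrow (ltnW (ltn_ord m))) sum1_card.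
  exact: card_ord.
pose mixed := setX [set x : 'I_n | x < i] (~: low).
have sub : E \subset [set A : {set 'I_n} | A \subset low & #|A| == 2]
    :|: [set [set p.1; p.2] | p in mixed].
  apply/subsetP=> A EA; have /eqP/cards2P[a0 [b0 [ab0 defA0]]] := E2 A EA.
  have [a [b [ab defA]]] : exists a b : 'I_n, a < b /\ A = [set a; b].
    move: ab0; rewrite -val_eqE neq_ltn => /orP[ab|ba]; first by exists a0, b0.
    by exists b0, a0; rewrite setUC.
  rewrite !inE; have [bq|qb] := ltnP b q.
    by rewrite E2 // eqxx andbT defA subUset !sub1set !inE bq (ltn_trans ab bq).
  apply/orP; right; apply/imsetP; exists (a, b) => //=.
  rewrite !inE /= -leqNgt qb andbT ltnNge; apply/negP => ia.
  by have := key a b ab ia qb; rewrite -defA EA.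
apply: leq_trans (subset_leq_card sub) _; apply: leq_trans (leq_card_setU _ _) _.
rewrite cards_draws card_lt leq_add2l; apply: leq_trans (leq_imset_card _ _) _.
by rewrite cardsX card_lt cardsCs setCK card_lt card_ord.
Qed.

(** The ends of each pair sum to [2 * s - 1] and the smaller one is [t], so distinct [t] give
    disjoint pairs. *)
Lemma antipodal_matching n (E : {set {set 'I_n}}) s (f g : nat -> 'I_n) :
    (forall t, t < s -> f t = t :> nat) -> (forall t, t < s -> g t = 2 * s - 1 - t :> nat) ->
    (forall t, t < s -> [set f t; g t] \in E) ->
  exists M : {set {set 'I_n}}, [/\ M \subset E, trivIset M & #|M| = s].
Proof.
move=> fE gE Efg; pose h (t : 'I_s) := [set f t; g t].
have dis (t u : 'I_s) : t != u -> [disjoint h t & h u].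
  rewrite -val_eqE /= => tu; have ts := ltn_ord t; have us := ltn_ord u.
  apply/pred0P => x /=; rewrite !inE.
  apply/negP => /andP[/orP[]/eqP-> /orP[]/eqP/(congr1 val)/=]; rewrite ?fE ?gE //; lia.
have hinj : injective h.
  move=> t u htu; apply/eqP; apply: contraTT isT => /dis; rewrite htu => /pred0P/(_ (f u)).
  by rewrite /= !inE eqxx.
exists (h @: 'I_s); split.
- by apply/subsetP => _ /imsetP[t _ ->]; apply: Efg.
- apply/trivIsetP => _ _ /imsetP[t _ ->] /imsetP[u _ ->] neq; apply: dis.
  by apply: contraNneq neq => ->.
- by rewrite card_imset // card_ord.
Qed.

(* The Erdos-Gallai bound on the number of edges of a graph without [s] disjoint edges,
   before maximising over [t]: the extremes [t = 0] and [t = s - 1] give the two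
   extremal graphs. *)
Lemma matching_or_sparse n (E : {set {set 'I_n}}) s :
    {in E, forall A : {set 'I_n}, #|A| = 2} -> 2 * s <= n ->
  (exists M : {set {set 'I_n}}, [/\ M \subset E, trivIset M & #|M| = s]) \/
  (exists2 t, t < s & #|E| <= 'C(2 * s - 1 - t, 2) + t * (n - (2 * s - 1 - t))).
Proof.
case: s => [|s] E2 sn.
  by left; exists set0; rewrite sub0set cards0; split=> //; apply/trivIsetP => A B; rewrite inE.
case: n E E2 sn => // n E E2 sn.
have [E' [sE' E'2 <- mE']] := exists_shifted E2.
pose f t : 'I_n.+1 := inord t; pose g t : 'I_n.+1 := inord (2 * s.+1 - 1 - t).
have fE t : t < s.+1 -> f t = t :> nat by move=> ts; rewrite inordK //; lia.
have gE t : t < s.+1 -> g t = 2 * s.+1 - 1 - t :> nat by move=> ts; rewrite inordK //; lia.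
(* Either all antipodal pairs are present and form the matching, or a missing one serves as the pair
   [{i, q}] of [shifted_missing_pair]. *)
have [/forallP all|] := boolP [forall t : 'I_s.+1, [set f t; g t] \in E'].
  have E'fg t : t < s.+1 -> [set f t; g t] \in E' by move=> ts; apply: (all (Ordinal ts)).
  by have [M [sM tM <-]] := antipodal_matching fE gE E'fg; left; apply: mE'.
rewrite negb_forall => /existsP[t nE]; right; exists (val t) => //=.
have := shifted_missing_pair sE' E'2 _ nE; rewrite fE // gE //; apply.
by have := ltn_ord t; lia.
Qed.

(** * Null pairs and the exchange argument *)

Definition null_pairs (C : finType) (mu : C -> C -> nat) : {set {set C}} :=
  [set A : {set C} | (#|A| == 2) &&
     [forall a in A, forall b in A, (a != b) ==> (mu a b == 0)]].

Lemma null_pairs2 (C : finType) (mu : C -> C -> nat) :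
  {in null_pairs mu, forall A : {set C}, #|A| = 2}.
Proof. by move=> A; rewrite inE => /andP[/eqP]. Qed.

Lemma null_pairsE (C : finType) (mu : C -> C -> nat) (A : {set C}) a b :
  A \in null_pairs mu -> a \in A -> b \in A -> a != b -> mu a b = 0.
Proof.
rewrite inE => /andP[_ /forall_inP nA] aA bA ab.
by have /forall_inP/(_ b bA)/implyP/(_ ab)/eqP := nA a aA.
Qed.

Lemma pair_null (C : finType) (mu : C -> C -> nat) a b :
    (forall a b, mu a b = mu b a) -> a != b -> mu a b = 0 -> [set a; b] \in null_pairs mu.
Proof.
move=> muC ab mu0; rewrite inE cards2 ab /=.
apply/forall_inP=> x; rewrite !inE => /orP[]/eqP->;
  apply/forall_inP=> y; rewrite !inE => /orP[]/eqP->;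
  by rewrite ?eqxx //= ?(muC b) mu0 eqxx implybT.
Qed.

(** An ordered pair of distinct colors is null or contributes at least 1 to the double sum. *)
Lemma card_null_pairs (C : finType) (mu : C -> C -> nat) :
    (forall a b, mu a b = mu b a) ->
  2 * 'C(#|C|, 2) <= 2 * #|null_pairs mu| + \sum_a \sum_b mu a b.
Proof.
move=> muC; rewrite -card_draws -(card_ordered_pairs (@null_pairs2 C mu)).
rewrite -card_ordered_pairs; last by move=> A; rewrite inE => /eqP.
rewrite pair_big /= -!sum1_card [X in X + _]big_mkcond -big_split big_mkcond /=.
apply: leq_sum => -[a b] _; rewrite inE /= inE cards2 inE /=.
have [//|ab] := eqVneq a b; have [m0|mu_gt0] := posnP (mu a b); last by rewrite eqxx; lia.
by rewrite (pair_null muC ab m0) eqxx.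
Qed.

Section Exchange.
Context {C : finType} (mu : C -> C -> nat) (muC : forall a b, mu a b = mu b a) (s : nat).

(** All that the counting retains from the failure of every list assignment; [blocked_mult] supplies
    it. *)
Definition saturated := forall (M : {set {set C}}), M \subset null_pairs mu -> trivIset M ->
  #|M| = s -> {in ~: cover M &, forall a b, a != b -> 2 <= mu a b}.

(** Replacing [[set a; b]] by [[set b; c]] in [M] gives another null matching of size [s], which
    leaves [a] and [c'] uncovered. *)
Lemma exchange (M : {set {set C}}) a b c c' : saturated ->
    M \subset null_pairs mu -> trivIset M -> #|M| = s ->
    [set a; b] \in M -> a != b -> c \notin cover M -> c' \notin cover M -> c' != c ->
    mu b c = 0 -> 2 <= mu a c'.
Proof.
move=> sat sM tM cM AM ab cR c'R c'c mubc.
have notin x : x \notin cover M -> forall B, B \in M -> x \notin B.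
  by move=> xM B BM; apply: contra xM => xB; apply/bigcupP; exists B.
have bA : b \in [set a; b] by rewrite !inE eqxx orbT.
have aA : a \in [set a; b] by rewrite !inE eqxx.
have neA x y : x \in [set a; b] -> y \notin cover M -> x != y.
  by move=> xA; apply: contraNneq => <-; apply/bigcupP; exists [set a; b].
have disA B x : B \in M -> B != [set a; b] -> x \in [set a; b] -> x \notin B.
  by move=> BM BA xA; have /pred0P/(_ x) /= := trivIsetP tM _ _ BM AM BA; rewrite xA andbT => ->.
pose M' := [set b; c] |: (M :\ [set a; b]).
have disbc B : B \in M :\ [set a; b] -> [disjoint [set b; c] & B].
  rewrite !inE => /andP[BA BM]; apply/pred0P => x /=; rewrite !inE.
  by apply/negP => /andP[/orP[]/eqP->];
    [rewrite (negPf (disA _ _ BM BA bA)) | rewrite (negPf (notin _ cR _ BM))].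
apply: (sat M').
- rewrite subUset sub1set pair_null ?neA //=.
  exact: subset_trans (subsetDl _ _) sM.
- apply/trivIsetP => B D; rewrite !inE => /orP[/eqP->|BM] /orP[/eqP->|DM]; rewrite ?eqxx // => BD.
  + by apply: disbc; rewrite !inE.
  + by rewrite disjoint_sym; apply: disbc; rewrite !inE.
  + by apply: (trivIsetP tM) => //; [case/andP: BM | case/andP: DM].
- have nM : [set b; c] \notin M.
    by apply: contra cR => bcM; apply/bigcupP; exists [set b; c]; rewrite // !inE eqxx orbT.
  by rewrite cardsU1 -cM (cardsD1 [set a; b] M) AM in_setD1 (negPf nM) andbF.
- rewrite inE; apply/bigcupP => -[B]; rewrite !inE => /orP[/eqP->|/andP[BA BM]].
    by rewrite !inE (negPf ab) (negPf (neA _ _ aA cR)).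
  by apply/negP; apply: disA.
- rewrite inE; apply/bigcupP => -[B]; rewrite !inE => /orP[/eqP->|/andP[BA BM]].
    by rewrite !inE (negPf c'c) eq_sym (negPf (neA _ _ bA c'R)).
  by apply/negP; apply: notin.
- exact: neA.
Qed.

(** By [exchange], [a] has multiplicity at least 2 with every uncovered color but [c]. The missing 2
    comes from [mu a c] if [b] has a second null partner, and otherwise from [b], positive on at
    least two other uncovered colors. *)
Lemma exchange_sum (M : {set {set C}}) a b c : saturated ->
    M \subset null_pairs mu -> trivIset M -> #|M| = s -> 3 <= #|~: cover M| ->
    [set a; b] \in M -> a != b -> c \notin cover M -> mu b c = 0 ->
  2 * #|~: cover M| <= \sum_(x in ~: cover M) mu a x + \sum_(x in ~: cover M) mu b x.
Proof.
move=> sat sM tM cM R3 AM ab cR mubc; set R := ~: cover M in R3 *.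
have inR x : (x \in R) = (x \notin cover M) by rewrite inE.
have cR' : c \in R by rewrite inR.
have a2 x : x \in R :\ c -> 2 <= mu a x.
  by rewrite in_setD1 inR => /andP[xc xR]; apply: (exchange sat sM tM cM AM ab cR).
have cardR : #|R| = #|R :\ c|.+1 by rewrite (cardsD1 c R) cR'.
have sum_a : 2 * #|R :\ c| <= \sum_(x in R :\ c) mu a x.
  by rewrite mulnC -sum_nat_const; apply: leq_sum.
rewrite !(big_setD1 c cR') /=.
have [|no_c'] := boolP [exists x in R :\ c, mu b x == 0].
  case/exists_inP=> x; rewrite in_setD1 inR => /andP[xc xR] /eqP mubx.
  have : 2 <= mu a c by apply: (exchange sat sM tM cM AM ab xR); rewrite // eq_sym.
  lia.
have : #|R :\ c| <= \sum_(x in R :\ c) mu b x.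
  rewrite -sum1_card; apply: leq_sum => x xR; rewrite lt0n.
  by apply: contra no_c' => mubx; apply/exists_inP; exists x.
lia.
Qed.

(** With [R] the uncovered colors, ordered pairs inside [R] give [2 * (#|R| * #|R|.-1)], and each
    edge of [M] gives [2 * #|R|] towards [R], in each of the two orders. *)
Lemma saturated_sum (M : {set {set C}}) : saturated ->
    M \subset null_pairs mu -> trivIset M -> #|M| = s -> 3 <= #|~: cover M| ->
  2 * (#|~: cover M| * (#|~: cover M|.-1 + 2 * s)) <= \sum_a \sum_b mu a b.
Proof.
move=> sat sM tM cM R3; pose R := ~: cover M.
have inner : 2 * (#|R| * #|R|.-1) <= \sum_(a in R) \sum_(b in R) mu a b.
  rewrite mulnCA -sum_nat_const; apply: leq_sum => a aR.
  rewrite (big_setD1 a aR) /= (cardsD1 a R) aR /= mulnC -sum_nat_const.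
  apply: leq_trans (leq_addl _ _); apply: leq_sum => b; rewrite in_setD1 => /andP[ba bR].
  by apply: sat sM tM cM _ _ aR bR _; rewrite eq_sym.
have outer : 2 * #|R| * s <= \sum_(a in cover M) \sum_(b in R) mu a b.
  rewrite big_trivIset //= mulnC -cM -sum_nat_const; apply: leq_sum => A AM.
  have A0 := subsetP sM A AM; have /eqP/cards2P[a [b [ab defA]]] := null_pairs2 A0.
  rewrite defA big_setU1 ?inE //= big_set1.
  have [|no_a] := boolP [exists x in R, mu a x == 0].
    case/exists_inP=> c cR /eqP muac; rewrite addnC.
    by apply: (exchange_sum (c := c)); rewrite 1?setUC -?defA 1?eq_sym //; rewrite inE in cR.
  have [|no_b] := boolP [exists x in R, mu b x == 0].
    case/exists_inP=> c cR /eqP mubc.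
    by apply: (exchange_sum (c := c)); rewrite -?defA //; rewrite inE in cR.
  have pos x y : ~~ [exists z in R, mu x z == 0] -> y \in R -> 0 < mu x y.
    by move=> no yR; rewrite lt0n; apply: contra no => ?; apply/exists_inP; exists y.
  rewrite mul2n -addnn -sum1_card.
  by apply: leq_add; apply: leq_sum => x xR; apply: pos.
have split_sum (F : C -> nat) : \sum_a F a = \sum_(a in R) F a + \sum_(a in cover M) F a.
  rewrite (bigID (mem R)) /=; congr (_ + _); apply: eq_bigl => x.
  by rewrite inE negbK.
rewrite split_sum (eq_bigr (fun a => \sum_(b in R) mu a b + \sum_(b in cover M) mu a b)) //.
rewrite big_split /= [X in _ + X + _]exchange_big /=.
have -> : \sum_(j in cover M) \sum_(i in R) mu i j = \sum_(a in cover M) \sum_(b in R) mu a b.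
  by apply: eq_bigr => a _; apply: eq_bigr => b _.
have : \sum_(a in cover M) \sum_(b in R) mu a b <= \sum_(a in cover M) \sum_b mu a b.
  by apply: leq_sum => a _; rewrite split_sum leq_addr.
move: inner outer; rewrite -/R mulnDr mulnDr; lia.
Qed.

End Exchange.

(** * List assignments, close pairs of precolored vertices, and extension *)

Section Extension.
Context {T : finType} (e : rel T) (P : {set T}) {n : nat} (d : T -> 'I_n).

Definition seen v : {set 'I_n} := [set d x | x in P & e v x].

Lemma lists_extend r (c : T -> 'I_r) (L : 'I_r -> {set 'I_n}) :
    symmetric e -> proper_coloring e c -> precoloring e P d ->
    (forall i j, i != j -> [disjoint L i & L j]) ->
    (forall v, v \notin P -> ~~ (L (c v) \subset seen v)) ->
  extends_to_coloring e P d.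
Proof.
move=> symE cP dP disL freeL.
(* The default [d v] is never reached: [freeL] makes the choice possible at every vertex off [P]. *)
pose f v := if v \in P then d v else odflt (d v) [pick a in L (c v) :\: seen v].
have fE v : v \notin P -> f v \in L (c v) :\: seen v.
  move=> vP; rewrite /f (negPf vP); case: pickP => //= none.
  case/subsetPn: (freeL v vP) => a aL aS.
  by have := none a; rewrite !inE aL aS.
have fPn x y : x \in P -> y \notin P -> e y x -> f y != f x.
  move=> xP yP yx; have := fE y yP; rewrite inE => /andP[+ _].
  apply: contraNneq => ->; rewrite /f xP; apply/imsetP; exists x => //.
  by rewrite inE xP.
exists f; split=> [x y xy|v vP]; last by rewrite /f vP.
have yx : e y x by rewrite symE.
have [xP|xP] := boolP (x \in P); have [yP|yP] := boolP (y \in P).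
- by rewrite /f xP yP dP.
- by rewrite eq_sym fPn.
- by rewrite fPn.
- have := fE x xP; have := fE y yP; rewrite !inE => /andP[_ fy] /andP[_ fx].
  have /pred0P/(_ (f x)) /= := disL _ _ (cP x y xy).
  by rewrite fx /=; apply: contraFneq => ->.
Qed.

(** Ordered vertex pairs count a close pair once when [a] and [b] differ and twice when they agree,
    so the double sum is uniformly twice [#|Dset e P 2|]. *)
Definition mult (a b : 'I_n) :=
  #|[set p : T * T | [&& [set p.1; p.2] \in Dset e P 2, d p.1 == a & d p.2 == b]]|.


Lemma multC a b : mult a b = mult b a.
Proof.
suff le x y : mult x y <= mult y x by apply/eqP; rewrite eqn_leq !le.
have swap_inj : injective (fun p : T * T => (p.2, p.1)) by move=> [u v] [u' v'] [-> ->].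
rewrite /mult -(card_imset _ swap_inj); apply: subset_leq_card.
apply/subsetP => _ /imsetP[[u v] + ->]; rewrite !inE /= => /and3P[? ? ?].
by rewrite setUC; apply/and3P.
Qed.

Lemma Dset2 k : {in Dset e P k, forall A : {set T}, #|A| = 2}.
Proof. by move=> A; rewrite inE => /andP[/andP[_ /eqP]]. Qed.

Lemma sum_mult : \sum_a \sum_b mult a b = 2 * #|Dset e P 2|.
Proof.
rewrite -(card_ordered_pairs (@Dset2 2)) pair_big /= -sum1_card.
rewrite (partition_big (fun p => (d p.1, d p.2)) xpredT) //=; apply: eq_bigr => -[a b] _ /=.
rewrite /mult -sum1_card; by apply: eq_bigl => p; rewrite !inE xpair_eqE.
Qed.

Lemma seen_pair v a b : symmetric e -> a \in seen v -> b \in seen v -> a != b ->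
  exists x y, [/\ e v x, e v y, d x = a, d y = b & [set x; y] \in Dset e P 2].
Proof.
move=> symE /imsetP[x + ->] /imsetP[y + ->]; rewrite !inE => /andP[xP vx] /andP[yP vy] dxy.
have xy : x != y by apply: contraNneq dxy => ->.
exists x, y; split=> //; rewrite inE subUset !sub1set xP yP cards2 xy /=.
have near u w : e v u -> e v w -> walk_le e 2 u w.
  move=> vu vw; apply/orP; right; apply/existsP; exists v; rewrite symE vu /=.
  by apply/orP; right; apply/existsP; exists w; rewrite vw /=.
apply/forall_inP => u; rewrite !inE => /orP[]/eqP->;
  apply/forall_inP => w; rewrite !inE => /orP[]/eqP->;
  by apply/implyP => _; apply: near.
Qed.

(** [R] fails as the list of the last class, whichever class is taken as last. *)
Definition blocked r (c : T -> 'I_r) (R : {set 'I_n}) :=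
  [forall i, exists v, [&& v \notin P, c v == i & R \subset seen v]].

(* A witness [x] of colour [a] near the blocking vertex of one class is not adjacent to the
   blocking vertex of the class of [x], which therefore has another witness. *)
Lemma blocked_mult r (c : T -> 'I_r) (R : {set 'I_n}) a b :
    symmetric e -> proper_coloring e c -> 0 < r -> blocked c R ->
  a \in R -> b \in R -> a != b -> 2 <= mult a b.
Proof.
move=> symE cP r0 /forallP bl aR bR ab.
have pick i : exists v x y, [/\ c v = i, e v x, d x = a, d y = b & [set x; y] \in Dset e P 2].
  have /existsP[v /and3P[_ /eqP cv /subsetP Rv]] := bl i.
  have [x [y [vx _ dx dy D]]] := seen_pair symE (Rv a aR) (Rv b bR) ab.
  by exists v, x, y.
have [_ [x [y [_ _ dx dy D]]]] := pick (Ordinal r0).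
have [v [x' [y' [cv vx' dx' dy' D']]]] := pick (c x).
have neq : (x, y) != (x', y').
  rewrite xpair_eqE negb_and; apply/orP; left; apply: contraTneq vx' => <-.
  by apply/negP => /cP; rewrite cv eqxx.
have <- : #|[set (x, y); (x', y')]| = 2 by rewrite cards2 neq.
apply: subset_leq_card; apply/subsetP => p; rewrite in_set2 => /orP[]/eqP->.
  by rewrite in_set /= D dx dy !eqxx.
by rewrite in_set /= D' dx' dy' !eqxx.
Qed.

Lemma unblocked_extends r (c : T -> 'I_r) (M : {set {set 'I_n}}) :
    symmetric e -> proper_coloring e c -> precoloring e P d ->
    M \subset null_pairs mult -> trivIset M -> #|M| = r.-1 -> ~~ blocked c (~: cover M) ->
  extends_to_coloring e P d.
Proof.
move=> symE cP dP sM tM cM; rewrite negb_forall => /existsP[i0 /existsPn free].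
(* [unlift i0] numbers the other [r.-1] classes, matching them with the enumeration of [M]; the
   unblocked class [i0] gets the uncovered colors. *)
pose L i := if unlift i0 i is Some j then nth set0 (enum M) j else ~: cover M.
have sizeM : size (enum M) = r.-1 by rewrite -cardE.
have nthM (j : 'I_r.-1) : nth set0 (enum M) j \in M.
  by rewrite -mem_enum mem_nth // sizeM.
have disR A : A \in M -> [disjoint A & ~: cover M].
  by move=> AM; rewrite disjoints_subset setCK; apply: bigcup_sup.
apply: (lists_extend (L := L) symE cP dP) => [i j ij|v vP]; rewrite /L.
  case: unliftP => [i'|] Ei; case: unliftP => [j'|] Ej.
  - apply: (trivIsetP tM) => //; rewrite nth_uniq ?sizeM ?enum_uniq //.
    by apply: contra ij => /eqP/val_inj E; rewrite Ei Ej E.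
  - exact: disR.
  - by rewrite disjoint_sym disR.
  - by rewrite Ei Ej eqxx in ij.
case: unliftP => [j _|cv]; last first.
  by have := free v; rewrite vP cv eqxx.
have Anull := subsetP sM _ (nthM j); apply/negP => /subsetP sub.
have /eqP/cards2P[a [b [ab defA]]] := null_pairs2 Anull.
rewrite defA in sub Anull.
have aA : a \in [set a; b] by rewrite !inE eqxx.
have bA : b \in [set a; b] by rewrite !inE eqxx orbT.
have [x [y [_ _ dx dy D]]] := seen_pair symE (sub _ aA) (sub _ bA) ab.
have /eqP := null_pairsE Anull aA bA ab; rewrite cards_eq0 => /eqP/setP/(_ (x, y)).
by rewrite in_set /= D dx dy !eqxx in_set0.
Qed.

Lemma extension_or_sparse r (c : T -> 'I_r) :
    symmetric e -> proper_coloring e c -> precoloring e P d -> 2 <= r -> 2 * r < n ->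
  extends_to_coloring e P d \/
  (n - 2 * r + 2) * (n - 1) <= #|Dset e P 2| \/
  exists2 t, t <= r - 2 &
    (n - 2 * r + 3 + t) * (n + 2 * r - 4 - 3 * t) <= 2 * #|Dset e P 2|.
Proof.
move=> symE cP dP r2 rn.
have s2n : 2 * r.-1 <= n by lia.
have [[M0 [sM0 tM0 cM0]]|[t tr leE]] := matching_or_sparse (@null_pairs2 _ mult) s2n; last first.
  right; right; exists t; first lia.
  have bin2x2 q : 2 * 'C(q, 2) = q * q.-1.
    rewrite bin2 mul2n halfK oddM; case: q => //= q.
    by rewrite andNb subn0.
  (* With [q = 2r - 3 - t], the bound is the factorization [n(n-1) - q(q-1) - 2t(n-q) =
     (n-q)(n+q-1-2t)]; the slacks [u] and [w] remove truncated subtraction. *)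
  have := card_null_pairs multC; rewrite sum_mult card_ord bin2x2.
  move: (bin2x2 (2 * r.-1 - 1 - t)) leE.
  have [u def_r] : exists u, r = t + 2 + u by exists (r - t - 2); lia.
  have [w def_n] : exists w, n = 2 * r + 1 + w by exists (n - 2 * r - 1); lia.
  have -> : 2 * r.-1 - 1 - t = t + 1 + 2 * u by lia.
  have -> : n - (t + 1 + 2 * u) = t + 4 + w by lia.
  have -> : n - 2 * r + 3 + t = t + 4 + w by lia.
  have -> : n + 2 * r - 4 - 3 * t = t + 5 + 4 * u + w by lia.
  have -> : n.-1 = 2 * t + 4 + 2 * u + w by lia.
  have -> : (t + 1 + 2 * u).-1 = t + 2 * u by lia.
  have n_eq : n = 2 * t + 5 + 2 * u + w by lia.
  rewrite [X in X * _ <= _]n_eq; move: 'C(_, _) #|null_pairs _| #|Dset _ _ _| => x y z; nia.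
have [|all_bl] := boolP [exists M : {set {set 'I_n}},
    [&& M \subset null_pairs mult, trivIset M, #|M| == r.-1 & ~~ blocked c (~: cover M)]].
  case/existsP=> M /and4P[sM tM /eqP cM nb]; left; exact: unblocked_extends sM tM cM nb.
right; left.
have sat : saturated mult r.-1.
  move=> M sM tM cM a b aR bR ab; apply: (@blocked_mult _ c (~: cover M)) => //; first lia.
  apply: contraNT all_bl => nb; apply/existsP; exists M.
  by rewrite sM tM cM eqxx nb.
have cardR : #|~: cover M0| = n - 2 * r + 2.
  rewrite cardsCs setCK card_ord -(eqP tM0) (eq_bigr (fun=> 2)).
    by rewrite sum_nat_const cM0; lia.
  by move=> A AM; apply: null_pairs2; apply: (subsetP sM0).
have := saturated_sum multC sat sM0 tM0 cM0; rewrite cardR sum_mult => /(_ _).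
have -> : (n - 2 * r + 2).-1 + 2 * r.-1 = n - 1 by lia.
by rewrite leq_mul2l /=; apply; lia.
Qed.
End Extension.

Theorem theorem8 (r k : nat) (T : finType) (e : rel T) (P : {set T}) (d : T -> 'I_(r + k)) :
  simple_graph e -> 2 <= r -> r < k -> colorable e r -> precoloring e P d ->
  (* (1): r < k <= (3r-7)/2 and |D| < min{ (k+3r-4)(k-r+3)/2, (k-r+2)(k+r-1) } *)
  ((2 * k + 7 <= 3 * r ->
    2 * #|Dset e P 2| < (k + 3 * r - 4) * (k - r + 3) ->
    #|Dset e P 2| < (k - r + 2) * (k + r - 1) ->
    extends_to_coloring e P d) /\
  (* (2): k > (3r-7)/2 and |D| < min{ (k+1)(k+2)/2, (k-r+2)(k+r-1) } *)
   (3 * r < 2 * k + 7 ->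
    2 * #|Dset e P 2| < (k + 1) * (k + 2) ->
    #|Dset e P 2| < (k - r + 2) * (k + r - 1) ->
    extends_to_coloring e P d)).
Proof.
move=> [symE _] r2 rk [c cP] dP.
have rn : 2 * r < r + k by lia.
case: (extension_or_sparse symE cP dP r2 rn) => [ext|[many|[t tr few]]]; first by split.
  have eq_bound : (r + k - 2 * r + 2) * (r + k - 1) = (k - r + 2) * (k + r - 1).
    by congr (_ * _); lia.
  by split=> _ _; rewrite ltnNge -eq_bound many.
(* The left-hand side of [few] is concave in [t], hence minimal at [t = 0] or [t = r - 2];
   the sign of [2 * k + 7 - 3 * r] tells which. *)
have [u def_r] : exists u, r = t + 2 + u by exists (r - t - 2); lia.
move: few; split=> rk2 few' _; exfalso; move: few few'; rewrite ltnNge => few /negP[].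
  apply: leq_trans few.
  have -> : r + k - 2 * r + 3 + t = k - r + 3 + t by lia.
  (* Such a [w] exists since [2k + 7 <= 3r] and [t <= r - 2]; the two products then differ by
     [t * w]. *)
  have [w def_B] : exists w, k + 3 * r - 4 = 3 * (k - r + 3) + 3 * t + w.
    by exists (k + 3 * r - 4 - (3 * (k - r + 3) + 3 * t)); lia.
  have -> : r + k + 2 * r - 4 - 3 * t = 3 * (k - r + 3) + w by lia.
  by rewrite def_B; nia.
apply: leq_trans few.
(* Here [3u <= 3r - 6 <= 2k]; with [v = k - u] the two products differ by [u * (w + 1)]. *)
have [w def_k] : exists w, 2 * k = 3 * u + w by exists (2 * k - 3 * u); lia.
have -> : r + k + 2 * r - 4 - 3 * t = k + 2 + 3 * u by lia.
have [v def_v] : exists v, k = u + v by exists (k - u); lia.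
have -> : r + k - 2 * r + 3 + t = v + 1 by lia.
by nia.
Qed.
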